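(* Let $\mathcal{M}$ be a 9-orbit map whose truncation $\mathrm{Tr}(\mathcal{M})$ is again a 9-orbit map. Then one of the following holds. (i) $\mathcal{M}$ is of type $9_C$ and $\mathrm{Tr}(\mathcal{M})$ is of type $9_{B_p}$; (ii) $\mathcal{M}$ is of type $9_{G_p}$ and $\mathrm{Tr}(\mathcal{M})$ is of type $9_{E_p}$; (iii) $\mathcal{M}$ is of type $9_{H_p}$ and $\mathrm{Tr}(\mathcal{M})$ is of type $9_{A_p}$; (iv) $\mathcal{M}$ is of type $9_I$ and $\mathrm{Tr}(\mathcal{M})$ is of type $9_{D_d}$; (v) $\mathcal{M}$ is of type $9_J$ and $\mathrm{Tr}(\mathcal{M})$ is of type $9_E$; (vi) $\mathcal{M}$ is of type $9_K$ and $\mathrm{Tr}(\mathcal{M})$ is of type $9_F$; (vii) $\mathcal{M}$ is of type $9_L$ and $\mathrm{Tr}(\mathcal{M})$ is of type $9_{F_p}$.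
   Context: A map $\mathcal{M}$ is a 2-cell embedding of a connected graph on a surface. Its flags are the triangles of the barycentric subdivision of $\mathcal{M}$, each identified with a triple $(\Phi_0,\Phi_1,\Phi_2)$ of a mutually incident vertex, edge and face; $\mathcal{F}(\mathcal{M})$ is the set of flags. For $i\in\{0,1,2\}$ let $s_i$ be the permutation of $\mathcal{F}(\mathcal{M})$ (acting on the right) sending each flag $\Phi$ to its $i$-adjacent flag $\Phi^{s_i}=\Phi^i$ (the neighbouring triangle differing from $\Phi$ only in the entry $\Phi_i$). The $s_i$ are fixed-point free involutions, $s_0s_2=s_2s_0$ is a fixed-point free involution, and $\langle s_0,s_1,s_2\rangle$ is transitive on $\mathcal{F}(\mathcal{M})$. The automorphism group $\Gamma(\mathcal{M})$ is (identified with) the group of permutations of $\mathcal{F}(\mathcal{M})$ commuting with $s_0,s_1,s_2$; it acts freely on flags. $\mathcal{M}$ is a $k$-orbit map if $\Gamma(\mathcal{M})$ has exactly $k$ orbits on $\mathcal{F}(\mathcal{M})$. The $s_i$ act on the set $\mathrm{Orb}(\mathcal{M})$ of flag-orbits by $\mathcal{O}_\Phi\cdot s_i=\mathcal{O}_{\Phi^{s_i}}$. Symmetry type graph: $T(\mathcal{M})$ has vertex set $\mathrm{Orb}(\mathcal{M})$, with an edge of colour $i$ joining two distinct orbits interchanged by $s_i$, and a semi-edge of colour $i$ at each orbit fixed by $s_i$. A type with $k$ vertices is given below by a triple $(\sigma_0,\sigma_1,\sigma_2)$ of permutations of $\{1,\dots,k\}$ in cycle notation: $\mathcal{M}$ is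 of that type iff there is a bijection $\mathrm{Orb}(\mathcal{M})\to\{1,\dots,k\}$ carrying the action of $s_i$ to $\sigma_i$ for $i=0,1,2$. (For $\mathrm{Tr}(\mathcal{M})$, the involutions $r_i$ below play the role of $s_i$.) Truncation: $\mathrm{Tr}(\mathcal{M})$ is the map on the same surface with flag set $\mathcal{F}(\mathcal{M})\times\{0,1,2\}$ and flag adjacencies $r_0,r_1,r_2$ given by $(\Phi,0)r_0=(\Phi^{s_1},0)$, $(\Phi,0)r_1=(\Phi^{s_2},0)$, $(\Phi,0)r_2=(\Phi,2)$; $(\Phi,1)r_0=(\Phi^{s_0},1)$, $(\Phi,1)r_1=(\Phi,2)$, $(\Phi,1)r_2=(\Phi^{s_2},1)$; $(\Phi,2)r_0=(\Phi^{s_1},2)$, $(\Phi,2)r_1=(\Phi,1)$, $(\Phi,2)r_2=(\Phi,0)$. Types on $\{1,\dots,9\}$. Write $\alpha=(1\,6)(2\,3)(4\,5)(8\,9)$, $\beta=(1\,2)(3\,4)(5\,6)(7\,8)$, $\gamma=(2\,3)(5\,6)(8\,9)$, $\delta=(1\,2)(4\,5)(7\,8)$. $9_{A_p}$: $\sigma_0=(1\,7)(2\,8)(3\,4)(5\,6)$, $\sigma_1=\alpha$, $\sigma_2=\beta$. $9_{D_d}$: $\sigma_0=(1\,7)(2\,8)(5\,6)$, $\sigma_1=\alpha$, $\sigma_2=\beta$. $9_E$: $\sigma_0=(1\,7)(2\,8)(3\,5)(4\,6)$, $\sigma_1=\alpha$, $\sigma_2=\beta$. $9_{E_p}$: $\sigma_0=(1\,7)(2\,8)(3\,6)(4\,5)$,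 $\sigma_1=\alpha$, $\sigma_2=\beta$. $9_{B_p}$: $\sigma_0=(1\,2)(3\,6)(4\,8)(5\,7)$, $\sigma_1=\gamma$, $\sigma_2=\delta$. $9_F$: $\sigma_0=(1\,2)(3\,6)(4\,7)(5\,8)$, $\sigma_1=\gamma$, $\sigma_2=\delta$. $9_{F_p}$: $\sigma_0=(3\,6)(4\,8)(5\,7)$, $\sigma_1=\gamma$, $\sigma_2=\delta$. $9_{H_p}$: $\sigma_0=(1\,6)(2\,3)(4\,9)(5\,8)$, $\sigma_1=(1\,7)(2\,8)(3\,4)(5\,6)$, $\sigma_2=\alpha$. $9_I$: $\sigma_0=(2\,3)(4\,9)(5\,8)$, $\sigma_1=(1\,7)(2\,8)(5\,6)$, $\sigma_2=\alpha$. $9_J$: $\sigma_0=(1\,3)(2\,6)(4\,9)(5\,8)$, $\sigma_1=(1\,7)(2\,8)(3\,5)(4\,6)$, $\sigma_2=\alpha$. $9_{G_p}$: $\sigma_0=(1\,2)(3\,6)(4\,9)(5\,8)$, $\sigma_1=(1\,7)(2\,8)(3\,6)(4\,5)$, $\sigma_2=\alpha$. $9_C$: $\sigma_0=(1\,4)(2\,3)(5\,9)(6\,8)$, $\sigma_1=(1\,2)(3\,6)(4\,8)(5\,7)$, $\sigma_2=\gamma$. $9_K$: $\sigma_0=(1\,4)(2\,3)(5\,8)(6\,9)$, $\sigma_1=(1\,2)(3\,6)(4\,7)(5\,8)$, $\sigma_2=\gamma$. $9_L$: $\sigma_0=(1\,4)(5\,9)(6\,8)$, $\sigma_1=(3\,6)(4\,8)(5\,7)$,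 $\sigma_2=\gamma$. *)

(* Defs.v *)
From mathcomp Require Import all_boot all_fingroup.
From mathcomp Require Import boolp classical_sets functions cardinality.

Set Implicit Arguments.
Unset Strict Implicit.
Unset Printing Implicit Defensive.

Local Open Scope classical_set_scope.

(** Maps are represented by their flags and flag adjacencies; the flag set may
    be infinite (the surface need not be compact). *)

Section Reach.
Variables (F : Type) (s0 s1 s2 : F -> F).

(** [reach x y]: some word in [s0, s1, s2] sends [x] to [y].  As the [s_i] are
    involutions in a map, words exhaust the group they generate. *)
Inductive reach (x : F) : F -> Prop :=
| reach_refl : reach x x
| reach_s0 y of reach x y : reach x (s0 y)
| reach_s1 y of reach x y : reach x (s1 y)
| reach_s2 y of reach x y : reach x (s2 y).

Lemma reach_trans x y z : reach x y -> reach y z -> reach x z.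
Proof.
move=> rxy; elim=> // {}z _ r; by [apply: reach_s0|apply: reach_s1|apply: reach_s2].
Qed.

End Reach.

Record surface_map := SurfaceMap {
  flag :> Type;
  s0 : flag -> flag;
  s1 : flag -> flag;
  s2 : flag -> flag;
  s0K : involutive s0;
  s1K : involutive s1;
  s2K : involutive s2;
  s0_fpf : forall x, s0 x <> x;
  s1_fpf : forall x, s1 x <> x;
  s2_fpf : forall x, s2 x <> x;
  s02C : forall x, s0 (s2 x) = s2 (s0 x);
  s02_fpf : forall x, s2 (s0 x) <> x;
  s_trans : forall x y, reach s0 s1 s2 x y }.

Section Orbits.
Variable M : surface_map.

Definition map_aut : set (M -> M) :=
  [set g | [/\ bijective g,
               forall x, g (s0 x) = s0 (g x),
               forall x, g (s1 x) = s1 (g x) &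
               forall x, g (s2 x) = s2 (g x)]].

Definition flag_orbit (x : M) : set M := [set g x | g in map_aut].

Definition Orb : set (set M) := range flag_orbit.

Definition korbit (k : nat) : Prop := (Orb #= `I_k)%card.

Definition has_type (k : nat) (t : 'S_k * 'S_k * 'S_k) : Prop :=
  let: (sigma0, sigma1, sigma2) := t in
  exists2 f : set M -> 'I_k, set_bij Orb setT f &
    forall x : M, [/\ f (flag_orbit (s0 x)) = sigma0 (f (flag_orbit x)),
                      f (flag_orbit (s1 x)) = sigma1 (f (flag_orbit x)) &
                      f (flag_orbit (s2 x)) = sigma2 (f (flag_orbit x))].

End Orbits.

Section Truncation.
Variable M : surface_map.

Definition tr_flag : Type := (M * 'I_3)%type.

Definition l0 : 'I_3 := @Ordinal 3 0 isT.
Definition l1 : 'I_3 := @Ordinal 3 1 isT.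
Definition l2 : 'I_3 := @Ordinal 3 2 isT.

Definition r0 (u : tr_flag) : tr_flag :=
  let: (x, j) := u in
  match val j with
  | 0 => (s1 x, l0)
  | 1 => (s0 x, l1)
  | _ => (s1 x, l2)
  end.

Definition r1 (u : tr_flag) : tr_flag :=
  let: (x, j) := u in
  match val j with
  | 0 => (s2 x, l0)
  | 1 => (x, l2)
  | _ => (x, l1)
  end.

Definition r2 (u : tr_flag) : tr_flag :=
  let: (x, j) := u in
  match val j with
  | 0 => (x, l2)
  | 1 => (s2 x, l1)
  | _ => (x, l0)
  end.

Lemma l3P (j : 'I_3) : [\/ j = l0, j = l1 | j = l2].
Proof.
case: j => [[|[|[|//]]] h]; [apply: Or31|apply: Or32|apply: Or33];
  exact: val_inj.
Qed.

Lemma r0K : involutive r0.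
Proof. by case=> x j; case: (l3P j) => ->; rewrite /r0 /= ?s0K ?s1K. Qed.

Lemma r1K : involutive r1.
Proof. by case=> x j; case: (l3P j) => ->; rewrite /r1 /= ?s2K. Qed.

Lemma r2K : involutive r2.
Proof. by case=> x j; case: (l3P j) => ->; rewrite /r2 /= ?s2K. Qed.

Lemma r0_fpf u : r0 u <> u.
Proof.
case: u => x j; case: (l3P j) => ->; rewrite /r0 /= => -[];
  by [exact: s1_fpf|exact: s0_fpf].
Qed.

Lemma r1_fpf u : r1 u <> u.
Proof.
by case: u => x j; case: (l3P j) => -> //; rewrite /r1 /= => -[]; exact: s2_fpf.
Qed.

Lemma r2_fpf u : r2 u <> u.
Proof.
by case: u => x j; case: (l3P j) => -> //; rewrite /r2 /= => -[]; exact: s2_fpf.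
Qed.

Lemma r02C u : r0 (r2 u) = r2 (r0 u).
Proof. by case: u => x j; case: (l3P j) => ->; rewrite /r0 /r2 //= s02C. Qed.

Lemma r02_fpf u : r2 (r0 u) <> u.
Proof.
case: u => x j; case: (l3P j) => -> //; rewrite /r0 /r2 /= => -[].
exact: s02_fpf.
Qed.

Lemma r_trans u v : reach r0 r1 r2 u v.
Proof.
have from0 x j : reach r0 r1 r2 (x, l0) (x, j).
  have h2 : reach r0 r1 r2 (x, l0) (x, l2).
    exact: (reach_s2 (reach_refl _ _ _ (x, l0))).
  case: (l3P j) => -> //; first by constructor.
  exact: (reach_s1 h2).
have to0 x j : reach r0 r1 r2 (x, j) (x, l0).
  have h2 : reach r0 r1 r2 (x, l2) (x, l0).
    exact: (reach_s2 (reach_refl _ _ _ (x, l2))).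
  case: (l3P j) => -> //.
  exact: (reach_trans (reach_s1 (reach_refl _ _ _ (x, l1))) h2).
have zero x y : reach r0 r1 r2 (x, l0) (y, l0).
  elim: (s_trans x y) => [|z _ h|z _ h|z _ h]; first by constructor.
  - apply: reach_trans (to0 _ l1).
    exact: (reach_s0 (reach_trans h (from0 z l1))).
  - exact: (reach_s0 h).
  - exact: (reach_s1 h).
case: u v => x i [y j].
exact: reach_trans (reach_trans (to0 x i) (zero x y)) (from0 y j).
Qed.

Definition Tr : surface_map :=
  SurfaceMap r0K r1K r2K r0_fpf r1_fpf r2_fpf r02C r02_fpf r_trans.

End Truncation.

(** The point [a] of [{1, ..., 9}] is the ordinal [a - 1]. *)
Definition tp (a b : nat) : 'S_9 := tperm (inord a.-1) (inord b.-1).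

Local Open Scope group_scope.

Definition alpha : 'S_9 := tp 1 6 * tp 2 3 * tp 4 5 * tp 8 9.
Definition beta  : 'S_9 := tp 1 2 * tp 3 4 * tp 5 6 * tp 7 8.
Definition gamma : 'S_9 := tp 2 3 * tp 5 6 * tp 8 9.
Definition delta : 'S_9 := tp 1 2 * tp 4 5 * tp 7 8.

Definition type_9Ap : 'S_9 * 'S_9 * 'S_9 :=
  (tp 1 7 * tp 2 8 * tp 3 4 * tp 5 6, alpha, beta).
Definition type_9Dd : 'S_9 * 'S_9 * 'S_9 :=
  (tp 1 7 * tp 2 8 * tp 5 6, alpha, beta).
Definition type_9E : 'S_9 * 'S_9 * 'S_9 :=
  (tp 1 7 * tp 2 8 * tp 3 5 * tp 4 6, alpha, beta).
Definition type_9Ep : 'S_9 * 'S_9 * 'S_9 :=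
  (tp 1 7 * tp 2 8 * tp 3 6 * tp 4 5, alpha, beta).
Definition type_9Bp : 'S_9 * 'S_9 * 'S_9 :=
  (tp 1 2 * tp 3 6 * tp 4 8 * tp 5 7, gamma, delta).
Definition type_9F : 'S_9 * 'S_9 * 'S_9 :=
  (tp 1 2 * tp 3 6 * tp 4 7 * tp 5 8, gamma, delta).
Definition type_9Fp : 'S_9 * 'S_9 * 'S_9 :=
  (tp 3 6 * tp 4 8 * tp 5 7, gamma, delta).
Definition type_9Hp : 'S_9 * 'S_9 * 'S_9 :=
  (tp 1 6 * tp 2 3 * tp 4 9 * tp 5 8, tp 1 7 * tp 2 8 * tp 3 4 * tp 5 6, alpha).
Definition type_9I : 'S_9 * 'S_9 * 'S_9 :=
  (tp 2 3 * tp 4 9 * tp 5 8, tp 1 7 * tp 2 8 * tp 5 6, alpha).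
Definition type_9J : 'S_9 * 'S_9 * 'S_9 :=
  (tp 1 3 * tp 2 6 * tp 4 9 * tp 5 8, tp 1 7 * tp 2 8 * tp 3 5 * tp 4 6, alpha).
Definition type_9Gp : 'S_9 * 'S_9 * 'S_9 :=
  (tp 1 2 * tp 3 6 * tp 4 9 * tp 5 8, tp 1 7 * tp 2 8 * tp 3 6 * tp 4 5, alpha).
Definition type_9C : 'S_9 * 'S_9 * 'S_9 :=
  (tp 1 4 * tp 2 3 * tp 5 9 * tp 6 8, tp 1 2 * tp 3 6 * tp 4 8 * tp 5 7, gamma).
Definition type_9K : 'S_9 * 'S_9 * 'S_9 :=
  (tp 1 4 * tp 2 3 * tp 5 8 * tp 6 9, tp 1 2 * tp 3 6 * tp 4 7 * tp 5 8, gamma).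
Definition type_9L : 'S_9 * 'S_9 * 'S_9 :=
  (tp 1 4 * tp 5 9 * tp 6 8, tp 3 6 * tp 4 8 * tp 5 7, gamma).

(* Main.v *)
From mathcomp Require Import all_boot all_fingroup.
From mathcomp Require Import boolp classical_sets functions cardinality.
Require Import Defs.

Set Implicit Arguments.
Unset Strict Implicit.
Unset Printing Implicit Defensive.

(** Write N for the truncation of M.  The layer of a flag of N is its second
    component.  The adjacencies of N act on layers as the identity, the
    transposition of the layers 1 and 2, and that of the layers 0 and 2.  So
    an automorphism of N turns the layer function into another function
    equivariant for the same action, and by connectedness two such functions
    that agree at one flag agree everywhere ([layer_agree]).  The automorphisms
    of M are those of N that preserve the layers ([map_aut_descend]).

    As 9 is odd, s2 fixes some orbit of M: an automorphism of M sends a flag x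
    to s2 x ([exists_reflected_flag]), and its lift to N sends the flag x of
    layer 0 to its image by the second adjacency of N.  Also some automorphism g
    of N moves the layers: otherwise the layer 0 alone would contribute nine
    orbits, and the layer 1 at least one more ([layer_moved]).  The layer function
    and its composites with g and with g after the lift are then pairwise
    different at every flag, so one of them is 0 there: every orbit of N
    meets the layer 0 ([layer0_meets_orbits]).  Counting, x |-> (x, 0) is a
    bijection between the orbits of M and those of N ([layer0_index]).  Hence,
    if r0, r1, r2 is the action of N on its nine orbits, M acts on its own nine
    by r2 r1 r0 r1 r2, r0 and r1.

    So N is determined by an action of three involutions on nine points with
    (r0 r2)^2 = (r1 r2)^3 = 1 for which r2 r1 r0 r1 r2, r0 and r1 already
    generate a transitive group.  An exhaustive search for such actions, in
    the style of coset enumeration ([fill_complete]), leaves only the seven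
    types listed for N ([nine_point_actions]); the formula above then gives the
    type of M. *)

(** * Flag orbits as fibres of a function *)

Section Automorphisms.
Variable M : surface_map.
Implicit Types (x y : M) (g h : M -> M).

Lemma map_aut_id : @map_aut M id.
Proof. by split=> //; exists id. Qed.

Lemma map_aut_comp g h : map_aut g -> map_aut h -> map_aut (g \o h).
Proof.
move=> [bg g0 g1 g2] [bh h0 h1 h2]; split=> [|x|x|x] /=.
- exact: bij_comp.
- by rewrite h0 g0.
- by rewrite h1 g1.
- by rewrite h2 g2.
Qed.

Lemma map_aut_inv g : map_aut g ->
  exists h, [/\ map_aut h, cancel g h & cancel h g].
Proof.
move=> [[h gK hK] g0 g1 g2]; exists h; split=> //; split=> [|x|x|x].
- by exists g.
- by apply: (can_inj gK); rewrite g0 !hK.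
- by apply: (can_inj gK); rewrite g1 !hK.
- by apply: (can_inj gK); rewrite g2 !hK.
Qed.

Definition equivalent x y := exists2 g, map_aut g & g x = y.

Lemma equivalent_sym x y : equivalent x y -> equivalent y x.
Proof. by move=> [g /map_aut_inv[h [ah gK _]] <-]; exists h. Qed.

Lemma equivalent_trans x y z :
  equivalent x y -> equivalent y z -> equivalent x z.
Proof.
by move=> [g ag <-] [h ah <-]; exists (h \o g) => //; apply: map_aut_comp.
Qed.

Lemma flag_orbit_eq x y : flag_orbit x = flag_orbit y <-> equivalent x y.
Proof.
split=> [exy|xy].
  have : flag_orbit y y by exists id => //; exact: map_aut_id.
  by rewrite -exy => -[g ag gx]; exists g.
apply/seteqP; split=> z [g ag <-].
  have [h ah hgx] : equivalent y (g x).
    by apply: equivalent_trans (equivalent_sym xy) _; exists g.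
  by exists h.
have [h ah hgx] : equivalent x (g y) by apply: equivalent_trans xy _; exists g.
by exists h.
Qed.

(** Working with a number for each flag avoids sets of sets: the fibres of an
    orbit index are the flag orbits. *)
Definition orbit_index k (c : M -> 'I_k) :=
  (forall i, exists x, c x = i) /\ (forall x y, c x = c y <-> equivalent x y).

Lemma korbit_index k : korbit M k -> exists c : M -> 'I_k, orbit_index c.
Proof.
case/card_set_bijP=> f [fI finj fsurj].
have fk x : f (flag_orbit x) < k by apply: fI; exists x.
exists (fun x => Ordinal (fk x)); split=> [i|x y].
  have [_ [x _ <-] fx] := fsurj i (ltn_ord i).
  by exists x; apply: val_inj.
rewrite -flag_orbit_eq; split=> [/(congr1 val)/= fxy|oxy].
  by apply: finj; rewrite ?inE //; [exists x|exists y].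
by apply: val_inj; rewrite /= oxy.
Qed.

Lemma index_has_type k (c : M -> 'I_k.+1) (p0 p1 p2 : 'S_k.+1) :
    orbit_index c ->
    (forall x, c (s0 x) = p0 (c x)) ->
    (forall x, c (s1 x) = p1 (c x)) ->
    (forall x, c (s2 x) = p2 (c x)) ->
  has_type M (p0, p1, p2).
Proof.
move=> [csurj cE] c0 c1 c2.
(* The value ord0 is only taken at sets of flags that are not orbits. *)
pose f (O : set M) := if pselect (exists x, O x) is left e
                      then c (projT1 (cid e)) else ord0.
have fE x : f (flag_orbit x) = c x.
  rewrite /f; case: pselect => [e|[]]; last by exists x, id => //; exact: map_aut_id.
  by apply/esym/cE; exact: projT2 (cid e).
exists f => [|x]; last by rewrite !fE.
split=> [//|_ _ /set_mem[x _ <-] /set_mem[y _ <-]|i _].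
  by rewrite !fE => /cE/flag_orbit_eq.
by have [x <-] := csurj i; exists (flag_orbit x) => //; exists x.
Qed.

Definition adj (i : nat) : M -> M :=
  match i with 0 => @s0 M | 1 => @s1 M | _ => @s2 M end.

Lemma map_aut_adj i g x : map_aut g -> g (adj i x) = adj i (g x).
Proof. by case: i => [|[|i]] [_ g0 g1 g2]; [exact: g0|exact: g1|exact: g2]. Qed.

Lemma adjK i : involutive (adj i).
Proof. by case: i => [|[|i]]; [exact: s0K|exact: s1K|exact: s2K]. Qed.

Lemma index_action k (c : M -> 'I_k) : orbit_index c ->
  exists r : nat -> 'I_k -> 'I_k, forall i x, c (adj i x) = r i (c x).
Proof.
move=> [/choice[e eK] cE]; exists (fun i j => c (adj i (e j))) => i x.
have [g ag gx] : equivalent x (e (c x)) by apply/cE; rewrite eK.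
by apply/cE; exists g => //; rewrite map_aut_adj // gx.
Qed.

End Automorphisms.

Lemma odd_involution_fixed (T : finType) (f : T -> T) :
  odd #|T| -> involutive f -> exists x, f x = x.
Proof.
move=> oddT fK; apply: contrapT => nofix.
(* Without a fixed point, the points moved up and those moved down in the
   order of enumeration would be exchanged by f. *)
pose up := [set x | enum_rank x < enum_rank (f x)].
have upC : ~: up = f @: up.
  apply/setP=> x; rewrite -{2}[x]fK (mem_imset _ _ (inv_inj fK)) !inE fK.
  rewrite -leqNgt leq_eqVlt; case: eqP => //= /val_inj/enum_rank_inj fx.
  by case: nofix; exists x.
move: oddT; rewrite -(cardsC up) upC (card_imset _ (inv_inj fK)).
by rewrite addnn odd_double.
Qed.

(** * The three layers of a truncation *)

Section Layers.
Variable M : surface_map.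
Implicit Types (x y : M) (u v : Tr M) (g h : Tr M -> Tr M).

Definition base u : M := (u : tr_flag M).1.
Definition layer u : 'I_3 := (u : tr_flag M).2.

Lemma layer_s0 u : layer (s0 u) = layer u.
Proof. by case: u => x j; case: (l3P j) => ->. Qed.

Lemma layer_s1 u : layer (s1 u) = tperm l1 l2 (layer u).
Proof.
by case: u => x j; case: (l3P j) => ->; rewrite /layer /= ?tpermL ?tpermR ?tpermD.
Qed.

Lemma layer_s2 u : layer (s2 u) = tperm l0 l2 (layer u).
Proof.
by case: u => x j; case: (l3P j) => ->; rewrite /layer /= ?tpermL ?tpermR ?tpermD.
Qed.

Lemma distinct_layers (i j m : 'I_3) :
  i <> j -> m <> j -> m <> i -> [\/ i = l0, j = l0 | m = l0].
Proof.
by case: (l3P i) (l3P j) (l3P m) => -> [] -> [] -> //;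
  [constructor 1|constructor 1|constructor 2|constructor 3|constructor 2|constructor 3].
Qed.

(** The equivariance of the layers propagates an agreement along adjacencies,
    and the adjacencies connect all flags. *)
Lemma layer_agree g h u v : map_aut g -> map_aut h ->
  layer (g u) = layer (h u) -> layer (g v) = layer (h v).
Proof.
move=> [_ g0 g1 g2] [_ h0 h1 h2] guhu.
elim: (s_trans u v) => [//|w _ e|w _ e|w _ e].
- by rewrite g0 h0 !layer_s0.
- by rewrite g1 h1 !layer_s1 e.
- by rewrite g2 h2 !layer_s2 e.
Qed.

Definition tr_lift (g : M -> M) u : Tr M := (g (base u), layer u).

Lemma map_aut_lift (g : M -> M) : map_aut g -> map_aut (tr_lift g).
Proof.
move=> [[h gK hK] g0 g1 g2].
split=> [|[x j]|[x j]|[x j]]; last 3 first.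
- by case: (l3P j) => ->; rewrite /tr_lift /= /r0 /= ?g0 ?g1 ?g2.
- by case: (l3P j) => ->; rewrite /tr_lift /= /r1 /= ?g0 ?g1 ?g2.
- by case: (l3P j) => ->; rewrite /tr_lift /= /r2 /= ?g0 ?g1 ?g2.
by exists (tr_lift h) => -[x j]; rewrite /tr_lift /= ?gK ?hK.
Qed.

Lemma equivalent_lift x y j :
  equivalent x y -> equivalent ((x, j) : Tr M) ((y, j) : Tr M).
Proof. by move=> [g ag <-]; exists (tr_lift g) => //; apply: map_aut_lift. Qed.

(** The layer 0 is a copy of the flags of M, and it determines the action of
    g on the layers 2 and 1, which are reached from it by the adjacencies. *)
Lemma map_aut_descend g : map_aut g -> (forall u, layer (g u) = layer u) ->
  exists2 h : M -> M, map_aut h & forall u, g u = tr_lift h u.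
Proof.
have descend f : map_aut f -> (forall u, layer (f u) = layer u) ->
    forall u, f u = tr_lift (fun x => base (f (x, l0))) u.
  move=> [_ f0 f1 f2] fl.
  have fx0 x : f (x, l0) = (base (f (x, l0)), l0).
    by have := fl (x, l0); case: (f _) => y j /= ->.
  have fx2 x : f (x, l2) = (base (f (x, l0)), l2).
    by rewrite -[(x, l2)]/(s2 ((x, l0) : Tr M)) f2 fx0.
  case=> x j; rewrite /tr_lift /=; case: (l3P j) => -> //.
  by rewrite -[(x, l1)]/(s1 ((x, l2) : Tr M)) f1 fx2.
move=> ag gl; have [g' [ag' gK g'K]] := map_aut_inv ag.
have gl' u : layer (g' u) = layer u by rewrite -gl g'K.
move: (descend _ ag gl) (descend _ ag' gl').
set h := (fun x => _); set h' := (fun x => _) => gE g'E.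
exists h => //; have [_ g0 g1 g2] := ag; split=> [|x|x|x].
- exists h' => x; first by have := gK (x, l0); rewrite gE g'E => /(congr1 base).
  by have := g'K (x, l0); rewrite g'E gE => /(congr1 base).
- by have := g0 (x, l1); rewrite !gE => /(congr1 base).
- by have := g0 (x, l0); rewrite !gE => /(congr1 base).
- by have := g1 (x, l0); rewrite !gE => /(congr1 base).
Qed.

Variables (k : nat) (cM : M -> 'I_k) (cT : Tr M -> 'I_k).
Hypotheses (odd_k : odd k) (cMP : orbit_index cM) (cTP : orbit_index cT).

(** The involution induced by s2 on an odd number of orbits has a fixed
    point. *)
Lemma exists_reflected_flag : exists x, equivalent x (s2 x).
Proof.
have [csurj cE] := cMP; have [r rE] := index_action cMP.
have rK : involutive (r 2).
  by move=> i; have [x <-] := csurj i; rewrite -!rE adjK.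
have [|i ri] := odd_involution_fixed _ rK; first by rewrite card_ord.
by have [x cx] := csurj i; exists x; apply/cE; rewrite -[s2 x]/(adj 2 x) rE cx ri.
Qed.

(** If the layers were preserved, the orbits through layer 0 would be as many
    as the orbits of M, hence all the orbits, although none of them reaches
    layer 1. *)
Lemma layer_moved : exists g u, map_aut g /\ layer (g u) <> layer u.
Proof.
apply: contrapT => fixed.
have gl g u : map_aut g -> layer (g u) = layer u.
  by move=> ag; apply: contrapT => ne; apply: fixed; exists g, u.
have [/choice[e eK] cME] := cMP; have [_ cTE] := cTP.
pose f i := cT (e i, l0).
have finj : injective f.
  move=> i j /cTE[g ag gij].
  have [h ah gE] := map_aut_descend ag (gl g ^~ ag).
  rewrite -(eK i) -(eK j); apply/cME; exists h => //.
  by move: gij; rewrite gE => /(congr1 base).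
have [x _] := exists_reflected_flag.
have [f' _ f'K] := injF_bij finj.
have /cTE[g ag gx] := f'K (cT (x, l1)).
by have := gl g (e (f' (cT (x, l1))), l0) ag; rewrite gx.
Qed.

(** Three layer functions that are pairwise different everywhere exhaust the
    three layers at each flag.  Oddness of k provides the third one: a g that
    only exchanged the layer 0 with another layer would not be enough. *)
Lemma layer0_meets_orbits v : exists x, equivalent v (x, l0).
Proof.
have [g [u [ag gu]]] := layer_moved.
have [x [h ah hx]] := exists_reflected_flag.
(* The three layer functions are compared at this flag w of layer 0. *)
pose w : Tr M := (x, l0).
have aL := map_aut_lift ah; have aid := @map_aut_id (Tr M).
have agL := map_aut_comp ag aL.
have Lw : tr_lift h w = s1 w by rewrite /tr_lift /= hx.
have gw0 : layer (g w) <> l0.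
  by move=> gw; apply: gu; exact: (@layer_agree g id w u ag aid gw).
have gLw : layer (g (tr_lift h w)) = tperm l1 l2 (layer (g w)).
  by rewrite Lw; case: ag => _ _ g1 _; rewrite g1 layer_s1.
have n1 : layer (g v) <> layer v.
  by move=> /(layer_agree (h := id) w ag aid).
have n2 : layer (g (tr_lift h v)) <> layer v.
  move=> /(layer_agree (g := g \o tr_lift h) (h := id) w agL aid) /=.
  by rewrite gLw; case: (l3P (layer (g w))) gw0 => -> //; rewrite ?tpermL ?tpermR.
have n3 : layer (g (tr_lift h v)) <> layer (g v).
  move=> /(layer_agree (g := g \o tr_lift h) (h := g) w agL ag) /=.
  by rewrite gLw; case: (l3P (layer (g w))) gw0 => -> //; rewrite ?tpermL ?tpermR.
have zero g' : map_aut g' -> layer (g' v) = l0 -> exists x, equivalent v (x, l0).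
  by move=> ag' <-; exists (base (g' v)); exists g' => //; case: (g' v).
have [e0|e0|e0] := distinct_layers n1 n2 n3.
- exact: (zero g).
- exact: (zero id).
- exact: (zero (g \o tr_lift h)).
Qed.

(** The map from the orbits of M to those of its truncation induced by layer
    0 is onto by the previous lemma; being a map between sets of k elements, it
    is one-to-one. *)
Lemma layer0_index : orbit_index (fun x => cT (x, l0)).
Proof.
have [/choice[e eK] cME] := cMP; have [cTsurj cTE] := cTP.
have surj i : exists x, cT (x, l0) = i.
  have [v <-] := cTsurj i; have [x vx] := layer0_meets_orbits v.
  by exists x; apply/cTE/equivalent_sym.
split=> // x y; split=> [|xy]; last exact/cTE/equivalent_lift.
pose f i := cT (e i, l0).
have fE z : cT (z, l0) = f (cM z).
  by apply/cTE/equivalent_lift/cME; rewrite eK.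
have [f' f'K] := choice (fun i => surj i).
have : cancel (fun i => cM (f' i)) f by move=> i; rewrite -fE.
by move=> /canF_sym/can_inj finj; rewrite !fE => /finj/cME.
Qed.

End Layers.

(** * Enumerating the actions on k points *)

Definition act (X : Type) (r : nat -> X -> X) (w : seq nat) (x : X) : X :=
  foldl (fun y i => r i y) x w.

(** A partially known action on points labelled by numbers: the triple
    (i, a, b) says that the generator i sends the point a to the point b. *)
Definition table := seq (nat * nat * nat).

Definition entry (E : table) i a : option nat :=
  ohead [seq e.2 | e <- E & e.1 == (i, a)].

Definition walk E w a : option nat :=
  foldl (fun o i => obind (entry E i) o) (Some a) w.

Section Enumeration.
Variables (k : nat) (relators : seq (seq nat)).

Definition compatible n (E : table) :=
  all (fun a => all (fun w => if walk E w a is Some b then b == a else true)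
                    relators) (iota 0 n).

Definition link (E : table) i a b : table := [:: (i, a, b), (i, b, a) & E].

(** All the completions of the table E on the labels below n.  The slot (i, a)
    is the value of the generator i at the label a; it receives either a label
    in use that the generator i does not reach yet, or the first fresh label n,
    and a branch that breaks a relator is cut.  A slot whose label is never
    introduced is skipped, so that a completion may have fewer than k
    labels. *)
Fixpoint fill slots (n : nat) (E : table) : seq (nat * table) :=
  if slots is (i, a) :: slots' then
    if (n <= a) || (entry E i a != None) then fill slots' n E else
    let grow m b := let E' := link E i a b in
      if compatible m E' then fill slots' m E' else [::] in
    flatten [seq grow n b | b <- iota 0 n & entry E i b == None]
      ++ (if n < k then grow n.+1 n else [::])
  else [:: (n, E)].

Variables (T : finType) (r : nat -> T -> T) (x0 : T).
Hypotheses (cardT : #|T| = k) (rK : forall i, involutive (r i)).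
Hypothesis r_rel : forall w, w \in relators -> act r w =1 id.

(** The list l names points of T, the label a standing for its a-th entry, in
    such a way that the table E is true of the action r.  Tables are symmetric
    because the generators are involutions. *)
Definition labels (l : seq T) (E : table) := uniq l /\
  forall i a b, (i, a, b) \in E ->
    [/\ (i, b, a) \in E, a < size l, b < size l & r i (nth x0 l a) = nth x0 l b].

Lemma labels_entry l E i a b : labels l E -> entry E i a = Some b ->
  [/\ (i, b, a) \in E, a < size l, b < size l & r i (nth x0 l a) = nth x0 l b].
Proof.
move=> [_ lE]; rewrite /entry; case Es: (filter _ _) => [//|e s] /= [eb].
have : e \in [:: e & s] by rewrite mem_head.
rewrite -Es mem_filter => /andP[/eqP e1 eE].
by apply: lE; rewrite -e1 -eb -surjective_pairing.
Qed.

Lemma labels_walk l E w a b : labels l E -> a < size l ->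
  walk E w a = Some b -> b < size l /\ act r w (nth x0 l a) = nth x0 l b.
Proof.
move=> lE; rewrite /walk /act; elim: w a => [|i w IHw] a al /=; first by case=> <-.
case Ea: (entry E i a) => [c|]; last first.
  by have -> : forall s, foldl (fun o j => obind (entry E j) o) None s = None by elim.
by have [_ _ cl ->] := labels_entry lE Ea; apply: IHw.
Qed.

Lemma labels_compatible l E : labels l E -> compatible (size l) E.
Proof.
move=> lE; apply/allP=> a; rewrite mem_iota => /andP[_ al].
apply/allP=> w wr; case Ew: (walk E w a) => [b|//].
have [bl] := labels_walk lE al Ew.
rewrite r_rel // => ab; case: (lE) => ul _.
by rewrite -(nth_uniq x0 bl al ul) -ab.
Qed.

Lemma entryN E i a b : entry E i a = None -> (i, a, b) \notin E.
Proof.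
rewrite /entry => E0; apply/negP=> abE.
have : (i, a, b) \in [seq e <- E | e.1 == (i, a)] by rewrite mem_filter eqxx.
by case: (filter _ _) E0.
Qed.

Lemma labels_link l E i a b : labels l E -> a < size l -> b < size l ->
  r i (nth x0 l a) = nth x0 l b -> labels l (link E i a b).
Proof.
move=> [ul lE] al bl rab; split=> // j c d; rewrite !inE => /or3P[||/lE].
- by case/eqP=> -> -> ->; rewrite eqxx orbT.
- by case/eqP=> -> -> ->; rewrite eqxx -rab rK.
- by move=> [-> -> -> ->]; rewrite !orbT.
Qed.

Lemma labels_rcons l E x : labels l E -> x \notin l -> labels (rcons l x) E.
Proof.
move=> [ul lE] xl; split=> [|i a b /lE[ba al bl rab]].
  by rewrite rcons_uniq xl.
by rewrite size_rcons !nth_rcons al bl; split=> //; exact: ltnW.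
Qed.

(** The branches of the search exhaust the possibilities for the image of a
    point under a generator: the search follows the branch that agrees with r,
    and names a new point whenever r leaves the points already named. *)
Lemma fill_complete slots l E : labels l E ->
  exists l' E', (size l', E') \in fill slots (size l) E /\ labels l' E'.
Proof.
elim: slots l E => [|[i a] slots IH] l E lE /=.
  by exists l, E; rewrite mem_head.
case: ifPn => [_|]; first exact: IH.
rewrite negb_or negbK -ltnNge => /andP[al /eqP Ea].
have [ul _] := lE; set y := r i (nth x0 l a).
have [yl|yl] := boolP (y \in l).
  have bl : index y l < size l by rewrite index_mem.
  have ry : r i (nth x0 l a) = nth x0 l (index y l) by rewrite nth_index.
  have lE' := labels_link lE al bl ry.
  have [l' [E' [E'f lE'']]] := IH _ _ lE'.
  exists l', E'; split=> //; rewrite mem_cat; apply/orP; left.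
  apply/flatten_mapP; exists (index y l); last by rewrite labels_compatible.
  rewrite mem_filter mem_iota bl andbT /=.
  case Eb: (entry E i _) => [c|//].
  have [cE _ cl] := labels_entry lE Eb.
  rewrite nth_index // rK => /eqP; rewrite nth_uniq // => /eqP ac.
  by have := entryN (index y l) Ea; rewrite ac cE.
have lk : size l < k.
  have uy : uniq (rcons l y) by rewrite rcons_uniq yl.
  by rewrite -cardT -(size_rcons l y) -(card_uniqP uy) max_card.
have lE' : labels (rcons l y) (link E i a (size l)).
  apply: labels_link (labels_rcons lE yl) _ _ _;
    rewrite ?size_rcons ?ltnS ?(ltnW al) //.
  by rewrite !nth_rcons al ltnn eqxx.
have [l' [E' [E'f lE'']]] := IH _ _ lE'; move: E'f; rewrite size_rcons => E'f.
exists l', E'; split=> //; rewrite mem_cat; apply/orP; right.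
by rewrite lk; have := labels_compatible lE'; rewrite size_rcons => ->.
Qed.

Definition confined n E (ws : seq (seq nat)) (S : seq nat) :=
  [&& 0 \in S, all (gtn n) S &
      all (fun a => all (fun w => oapp (mem S) false (walk E w a)) ws) S].

(** A set of labels closed under a connecting list of words names all the
    points. *)
Lemma confined_size l E S ws : labels l E ->
    (forall A : pred T, (exists x, A x) ->
      (forall w x, w \in ws -> A x -> A (act r w x)) -> forall x, A x) ->
    confined (size l) E ws S ->
  k <= size S.
Proof.
move=> lE conn /and3P[S0 /allP Sl /allP Sw].
pose A := [seq nth x0 l a | a <- S].
have AT : forall x, x \in A.
  apply: (conn (mem A)); first by exists (nth x0 l 0); apply: map_f.
  move=> w _ wws /mapP[a aS ->].
  have := allP (Sw a aS) w wws; case Ea: (walk E w a) => [b|//] /= bS.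
  have [_ ->] := labels_walk lE (Sl a aS) Ea.
  exact: (map_f (nth x0 l)).
rewrite -cardT cardE -(size_map (nth x0 l)) uniq_leq_size ?enum_uniq //.
Qed.

End Enumeration.

(** * The actions of a truncation on nine orbits *)

(** The permutations of the types as functions on numbers, which can be
    computed; the point a of the types is the number a - 1. *)
Definition swap (p : nat * nat) i :=
  if i == p.1.-1 then p.2.-1 else if i == p.2.-1 then p.1.-1 else i.

Definition swaps (s : seq (nat * nat)) i := foldl (fun j p => swap p j) i s.

(** The types of the truncation, in the order of the cases of the theorem. *)
Definition tr_types : seq (seq (seq (nat * nat))) :=
  let a := [:: (1, 6); (2, 3); (4, 5); (8, 9)] in
  let b := [:: (1, 2); (3, 4); (5, 6); (7, 8)] in
  let c := [:: (2, 3); (5, 6); (8, 9)] in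
  let d := [:: (1, 2); (4, 5); (7, 8)] in
  [:: [:: [:: (1, 2); (3, 6); (4, 8); (5, 7)]; c; d];
      [:: [:: (1, 7); (2, 8); (3, 6); (4, 5)]; a; b];
      [:: [:: (1, 7); (2, 8); (3, 4); (5, 6)]; a; b];
      [:: [:: (1, 7); (2, 8); (5, 6)]; a; b];
      [:: [:: (1, 7); (2, 8); (3, 5); (4, 6)]; a; b];
      [:: [:: (1, 2); (3, 6); (4, 7); (5, 8)]; c; d];
      [:: [:: (3, 6); (4, 8); (5, 7)]; c; d]].

Definition tr_relators := [:: [:: 0; 2; 0; 2]; [:: 1; 2; 1; 2; 1; 2]].

(** The adjacencies of the map, read on layer 0 of its truncation. *)
Definition layer0_words := [:: [:: 2; 1; 0; 1; 2]; [:: 0]; [:: 1]].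

Definition slots := [seq (i, a) | a <- iota 0 9, i <- [:: 1; 2; 0]].

(** Labels are introduced in increasing order, each as the image of an earlier
    one.  Hence a label map from E to the type t that sends 0 to b is forced,
    and is read off the entries in the order in which they were added. *)
Definition transport (t : seq (seq (nat * nat))) (E : table) b :=
  foldl (fun m e => if e.2 == size m
                    then rcons m (swaps (nth [::] t e.1.1) (nth 0 m e.1.2))
                    else m) [:: b] (rev E).

Definition isomorphism E t (m : seq nat) :=
  [&& size m == 9, uniq m, all (gtn 9) m &
      all (fun a => all (fun i =>
        oapp (fun b => nth 0 m b == swaps (nth [::] t i) (nth 0 m a)) false
             (entry E i a)) (iota 0 3)) (iota 0 9)].

(** Nine rounds are enough: a round adds a label unless the set is already
    closed, and there are at most nine labels. *)
Definition reachable E ws :=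
  iter 9 (fun S => undup (S ++ pmap (fun u => walk E u.1 u.2)
                                    [seq (w, a) | w <- ws, a <- S])) [:: 0].

(** The two fates of a completed table: the words of layer 0 reach fewer than
    nine labels, which covers the tables with fewer than nine labels, or the
    table is one of the listed types. *)
Definition accounted nE := let: (n, E) := nE in
  let S := reachable E layer0_words in
  (size S < 9) && confined n E layer0_words S ||
  (n == 9) && has (fun t => has (fun b => isomorphism E t (transport t E b))
                                (iota 0 9)) tr_types.


Lemma all_accounted : all accounted (fill 9 tr_relators slots 1 [:: (2, 0, 0)]).
Proof. by vm_compute. Qed.

(** Transitivity is asked of the words of layer 0, that is, of the action of
    the map whose truncation is considered, not only of r: this excludes the
    actions that themselves carry an equivariant layer function. *)
Lemma nine_point_actions (T : finType) (r : nat -> T -> T) :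
    #|T| = 9 -> (forall i, involutive (r i)) ->
    (forall w, w \in tr_relators -> act r w =1 id) ->
    (forall A : pred T, (exists x, A x) ->
      (forall w x, w \in layer0_words -> A x -> A (act r w x)) ->
      forall x, A x) ->
  exists t (h : T -> 'I_9), [/\ t \in tr_types, injective h &
    forall i x, i < 3 -> h (r i x) = swaps (nth [::] t i) (h x) :> nat].
Proof.
move=> cardT rK r_rel conn.
(* Starting at a fixed point of the third generator shortens the search. *)
have [|x0 x0_fixed] := odd_involution_fixed _ (rK 2); first by rewrite cardT.
have lab0 : labels r x0 [:: x0] [:: (2, 0, 0)].
  by split=> // i a b; rewrite inE => /eqP[-> -> ->].
have [l [E [lE_in lE]]] := fill_complete cardT rK r_rel slots lab0.
have [ul _] := lE.
have := allP all_accounted _ lE_in; rewrite /accounted.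
case/orP=> [/andP[small] /(confined_size cardT lE conn)|].
  by rewrite leqNgt small.
case/andP=> /eqP sl /hasP[t t_in /hasP[b _]].
move: (transport t E b) => m /and4P[/eqP sm um /allP m9 /allP mE].
have in_l x : x \in l.
  have [||_ ->] := uniq_min_size ul (s2 := enum T); last exact: mem_enum.
    by move=> y _; rewrite mem_enum.
  by rewrite -cardE cardT sl.
have il x : index x l < 9 by rewrite -sl index_mem.
have hv x : @inord 8 (nth 0 m (index x l)) = nth 0 m (index x l) :> nat.
  by rewrite inordK //; apply: m9; rewrite mem_nth ?sm.
exists t, (fun x => inord (nth 0 m (index x l))); split=> // [x y|i x i3].
  move=> /(congr1 val) /=; rewrite !hv => /eqP; rewrite nth_uniq ?sm // => /eqP ixy.
  by rewrite -(nth_index x0 (in_l x)) ixy nth_index.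
rewrite !hv.
have ix : index x l \in iota 0 9 by rewrite mem_iota il.
have := allP (mE _ ix) i; rewrite mem_iota i3 => /(_ isT).
case Eix: (entry E i _) => [c|//] /eqP <-.
by have [_ _ cl] := labels_entry lE Eix; rewrite nth_index // => ->; rewrite index_uniq.
Qed.

(** * Naming the types *)

Lemma val_tp a b (i : 'I_9) : a.-1 < 9 -> b.-1 < 9 ->
  tp a b i = swap (a, b) i :> nat.
Proof.
move=> a9 b9; rewrite /tp /swap permE /= -!val_eqE /= !inordK //.
by case: ifP => _; [|case: ifP => _]; rewrite ?inordK.
Qed.

Lemma index_comp (M : surface_map) k (c : M -> 'I_k) (h : 'I_k -> 'I_k) :
  orbit_index c -> injective h -> orbit_index (h \o c).
Proof.
move=> [csurj cE] hinj; split=> [i|x y].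
  have [h' _ h'K] := injF_bij hinj; have [x cx] := csurj (h' i).
  by exists x; rewrite /= cx h'K.
by rewrite -cE /=; split=> [/hinj|->].
Qed.

(** The adjacency s0 of M acts in layer 1 of the truncation, which is reached
    from layer 0 through layer 2: this gives the word of length five. *)
Lemma layer0_adj (M : surface_map) (x : M) :
  [/\ (s0 x, l0) = act (@adj (Tr M)) [:: 2; 1; 0; 1; 2] (x, l0),
      (s1 x, l0) = act (@adj (Tr M)) [:: 0] (x, l0) &
      (s2 x, l0) = act (@adj (Tr M)) [:: 1] (x, l0)].
Proof. by []. Qed.

Lemma tr_relatorsP (M : surface_map) w (u : Tr M) :
  w \in tr_relators -> act (@adj (Tr M)) w u = u.
Proof.
case: u => x j; rewrite !inE => /orP[]/eqP->; case: (l3P j) => ->;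
  by rewrite /act /= /r0 /r1 /r2 /= ?s02C ?s0K ?s1K ?s2K.
Qed.

Theorem proposition11 (M : surface_map) (HM : korbit M 9) (HT : korbit (Tr M) 9) :
     (has_type M type_9C  /\ has_type (Tr M) type_9Bp)
  \/ (has_type M type_9Gp /\ has_type (Tr M) type_9Ep)
  \/ (has_type M type_9Hp /\ has_type (Tr M) type_9Ap)
  \/ (has_type M type_9I  /\ has_type (Tr M) type_9Dd)
  \/ (has_type M type_9J  /\ has_type (Tr M) type_9E)
  \/ (has_type M type_9K  /\ has_type (Tr M) type_9F)
  \/ (has_type M type_9L  /\ has_type (Tr M) type_9Fp).
Proof.
have [cM cMP] := korbit_index HM; have [c cP] := korbit_index HT.
have c0P := layer0_index (isT : odd 9) cMP cP.
have [csurj _] := cP; have [c0surj _] := c0P.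
have [r rE] := index_action cP.
have actE w u : c (act (@adj (Tr M)) w u) = act r w (c u).
  by elim: w u => [//|i w IHw] u; rewrite /= IHw rE.
have rK i : involutive (r i).
  by move=> j; have [u <-] := csurj j; rewrite -!rE adjK.
have r_rel w : w \in tr_relators -> act r w =1 id.
  by move=> wr j; have [u <-] := csurj j; rewrite -actE tr_relatorsP.
have conn (A : pred 'I_9) : (exists j, A j) ->
    (forall w j, w \in layer0_words -> A j -> A (act r w j)) -> forall j, A j.
  move=> [i Ai] Aw j; have [x cx] := c0surj i; have [y <-] := c0surj j.
  have layer0_step z w : w \in layer0_words ->
      A (c (z, l0)) -> A (c (act (@adj (Tr M)) w (z, l0))).
    by move=> ww Az; rewrite actE; apply: Aw.
  have Ax : A (c (x, l0)) by rewrite cx.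
  elim: (s_trans x y) => [//|z _ Az|z _ Az|z _ Az];
  have [e0 e1 e2] := layer0_adj z.
  - by rewrite e0; apply: layer0_step.
  - by rewrite e1; apply: layer0_step.
  - by rewrite e2; apply: layer0_step.
have [t [h [t_in hinj hE]]] := nine_point_actions (card_ord 9) rK r_rel conn.
(* One numbering of the orbits, read on all flags or on layer 0 only, gives
   both types. *)
have types (q0 q1 q2 m0 : 'S_9) :
    (forall j, q0 j = swaps (nth [::] t 0) j :> nat) ->
    (forall j, q1 j = swaps (nth [::] t 1) j :> nat) ->
    (forall j, q2 j = swaps (nth [::] t 2) j :> nat) ->
    (forall j, m0 j = q2 (q1 (q0 (q1 (q2 j))))) ->
  has_type M (m0, q0, q1) /\ has_type (Tr M) (q0, q1, q2).
  move=> q0E q1E q2E m0E.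
  have q0r u : h (c (@s0 (Tr M) u)) = q0 (h (c u)).
    by apply: val_inj; rewrite /= q0E -hE // -rE.
  have q1r u : h (c (@s1 (Tr M) u)) = q1 (h (c u)).
    by apply: val_inj; rewrite /= q1E -hE // -rE.
  have q2r u : h (c (@s2 (Tr M) u)) = q2 (h (c u)).
    by apply: val_inj; rewrite /= q2E -hE // -rE.
  split; last exact: (index_has_type (index_comp cP hinj)).
  apply: (index_has_type (index_comp c0P hinj)) => x /=;
  have [e0 e1 e2] := layer0_adj x.
  - by rewrite e0 m0E -!(q0r, q1r, q2r).
  - by rewrite e1 -q0r.
  - by rewrite e2 -q1r.
move: t_in; rewrite !inE.
do 6?[case/orP=> [/eqP te|rest]; [left|right; move: rest]]; last move=> /eqP te.
all: apply: types => j; try (apply: val_inj); rewrite ?te /= ?permM ?val_tp //.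
(* What is left compares two explicit functions on the nine numbers. *)
all: by case: j => [[|[|[|[|[|[|[|[|[|//]]]]]]]]] ?].
Qed.
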